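(* Let $D=(E,\mathcal F)$ be a vf-safe delta-matroid, and let $\sigma\in\{\ast\times,\times\ast\}$. Then there exists a subset $A\subseteq E$, together with an ordering $e_1,\ldots,e_k$ of the elements of $A$, such that $$\omega(D^{\sigma|A})=\max_{B\subseteq E}\omega(D^{\sigma|B}),$$ and the sequence $$\omega(D),\ \omega(D^{\sigma|\{e_1\}}),\ \omega(D^{\sigma|\{e_1,e_2\}}),\ \ldots,\ \omega(D^{\sigma|A})$$ is non-decreasing.
   Context: A set system is a pair $D=(E,\mathcal F)$ with $E$ a finite set and $\mathcal F\subseteq 2^E$; the members of $\mathcal F$ are the feasible sets. $D$ is proper if $\mathcal F\neq\emptyset$. A delta-matroid is a proper set system such that for all $X,Y\in\mathcal F$ and every $u\in X\triangle Y$ there exists $v\in X\triangle Y$ (possibly $v=u$) with $X\triangle\{u,v\}\in\mathcal F$, where $\triangle$ is symmetric difference. For proper $D$, $r(D_{\max})$ and $r(D_{\min})$ denote the largest and smallest cardinality of a feasible set, and the width is $\omega(D)=r(D_{\max})-r(D_{\min})$. Twist: for $A\subseteq E$, $D^{\ast|A}=(E,\{F\triangle A\mid F\in\mathcal F\})$. Loop complementation: for $e\in E$, $D^{\times|e}=(E,\mathcal F')$ with $\mathcal F'=\mathcal F\,\triangle\,\{F\cup\{e\}\mid F\in\mathcal F,\ e\notin F\}$. Loop complementations on distinct elements commute, and for $A\subseteq E$, $D^{\times|A}$ is obtained by applying loop complementation to every element of $A$. These operations preserve properness. Words are read left to right: $D^{\ast\times|A}=(D^{\ast|A})^{\times|A}$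 and $D^{\times\ast|A}=(D^{\times|A})^{\ast|A}$; also $D^{\sigma|\emptyset}=D$. A delta-matroid $D$ is vf-safe if every set system obtained from $D$ by an arbitrary finite sequence of twists and loop complementations (on elements or subsets of $E$) is again a delta-matroid. *)

(* Defs.v *)
(* Library: Mathematical Components.  A set system (E, F) is a finite type E
   together with its collection of feasible sets F : {set {set E}}. *)
From mathcomp Require Import all_boot.

Set Implicit Arguments.
Unset Strict Implicit.
Unset Printing Implicit Defensive.

Section DeltaMatroids.

Variable E : finType.
Implicit Types (A B X Y : {set E}) (D : {set {set E}}).

Definition symdiff (T : finType) (A B : {set T}) : {set T} :=
  (A :\: B) :|: (B :\: A).

Definition proper_system D : Prop := D != set0.

Definition delta_matroid D : Prop :=
  proper_system D /\
  forall X Y, X \in D -> Y \in D ->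
  forall u, u \in symdiff X Y ->
  exists v, v \in symdiff X Y /\ symdiff X [set u; v] \in D.

Definition rmax D : nat := \max_(X in D) #|X|.

(* The default value #|E| bounds all cardinalities, so it is harmless when D is
   proper; see rmin_le and rmin_attained. *)
Definition rmin D : nat := \big[minn/#|E|]_(X in D) #|X|.

Definition width D : nat := rmax D - rmin D.

Definition twist D A : {set {set E}} := [set symdiff X A | X in D].

Definition loopc1 D (e : E) : {set {set E}} :=
  symdiff D [set e |: X | X in D & e \notin X].

(* The order of enum A is immaterial, by loopc1C. *)
Definition loopc D A : {set {set E}} := foldl loopc1 D (enum A).

Inductive letter := Star | Times.

Definition act D (l : letter) A : {set {set E}} :=
  match l with Star => twist D A | Times => loopc D A end.

(* D^{w|A}: the letters of w are applied to A from left to right. *)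
Definition act_word D (w : seq letter) A : {set {set E}} :=
  foldl (fun D' l => act D' l A) D w.

(* Operations on single elements are operations on singletons, by loopc_set1;
   the empty sequence of operations gives D itself. *)
Definition vf_safe D : Prop :=
  forall ops : seq (letter * {set E}),
    delta_matroid (foldl (fun D' o => act D' o.1 o.2) D ops).

Lemma in_symdiff (T : finType) (A B : {set T}) x :
  (x \in symdiff A B) = (x \in A) (+) (x \in B).
Proof. by rewrite !inE; case: (x \in A); case: (x \in B). Qed.

Lemma rmin_le D X : X \in D -> rmin D <= #|X|.
Proof.
move=> XD; rewrite /rmin; have := mem_index_enum X.
elim: (index_enum _) => // Y s IHs; rewrite inE big_cons.
case/predU1P=> [<-|/IHs leX]; first by rewrite XD geq_minl.
by case: ifP => // _; apply: leq_trans (geq_minr _ _) leX.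
Qed.

Lemma rmin_attained D : proper_system D -> exists2 X, X \in D & rmin D = #|X|.
Proof.
case/set0Pn=> X0 X0D.
have [X XD Xmin] := arg_minnP (fun X : {set E} => #|X|) X0D.
exists X => //; apply/eqP; rewrite eqn_leq rmin_le //=.
rewrite /rmin; elim/big_ind: _ => [|m n hm hn|Y /Xmin //]; first exact: max_card.
by rewrite leq_min hm.
Qed.

Lemma in_loopc1 D e X :
  (X \in loopc1 D e) = (X \in D) (+) ((e \in X) && (X :\ e \in D)).
Proof.
rewrite in_symdiff; congr addb; apply/imsetP/andP => [[Y]|[eX XD]].
  by rewrite inE => /andP[YD eY] ->; rewrite setU11 setU1K.
by exists (X :\ e); rewrite ?inE ?XD ?eqxx // setD1K.
Qed.

Lemma loopc1C D e f : loopc1 (loopc1 D e) f = loopc1 (loopc1 D f) e.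
Proof.
have [->//|nef] := eqVneq e f.
apply/setP=> X; rewrite !in_loopc1 !in_setD1 nef eq_sym nef /=.
rewrite !setDDl (setUC [set f]).
case: (e \in X) (f \in X) => [] [] //=; rewrite ?addbF //; first exact: addbACA.
Qed.

Lemma loopc_set1 D e : loopc D [set e] = loopc1 D e.
Proof. by rewrite /loopc enum_set1. Qed.

Lemma act_word_set0 D w : act_word D w set0 = D.
Proof.
rewrite /act_word; elim: w => //= l w IHw; suff -> : act D l set0 = D by [].
case: l; last by rewrite /= /loopc enum_set0.
rewrite -[RHS]imset_id; apply: eq_imset => X.
by apply/setP=> x; rewrite in_symdiff inE addbF.
Qed.

End DeltaMatroids.

(* Main.v *)
Require Import Defs.
From mathcomp Require Import all_boot.
From mathcomp Require Import zify.

(* Call e inert in D when e lies in every largest and in no smallest feasible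
   set.  If e is not inert, then one of the two extreme cardinalities moves
   outwards by 1 in D^{sigma|e}, while the other moves inwards by at most 1, so
   the width does not drop.  If all elements of A are inert, then the width of
   D^{sigma|A} is at most that of D: a member W of D^{sigma|A} agrees outside A
   with some feasible set F of D, and F contains a smallest feasible set, which
   is disjoint from A, and is contained in a largest one, which contains A.
   Hence as long as D^{sigma|A} is wider than D, some e in A can be processed
   without decreasing the width, and we replace D by D^{sigma|e} and A by A - e. *)

Set Implicit Arguments.
Unset Strict Implicit.
Unset Printing Implicit Defensive.

Section Width.

Variable E : finType.
Implicit Types (A B X Y F : {set E}) (D : {set {set E}}) (e : E) (s : seq E).

(** * Symmetric differences and membership in twists *)

Lemma symdiffK A : involutive (fun X => symdiff X A).
Proof. by move=> X; apply/setP=> x; rewrite !in_symdiff addbK. Qed.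

Lemma in_twist D A X : (X \in twist D A) = (symdiff X A \in D).
Proof.
apply/imsetP/idP => [[Y YD ->]|XD]; first by rewrite symdiffK.
by exists (symdiff X A); rewrite ?symdiffK.
Qed.

Lemma symdiff_set1_in e X : e \in X -> symdiff X [set e] = X :\ e.
Proof.
move=> eX; apply/setP=> x; rewrite in_symdiff !inE.
by have [->|] := eqVneq x e; rewrite ?eX ?addbF.
Qed.

Lemma symdiff_set1_notin e X : e \notin X -> symdiff X [set e] = e |: X.
Proof.
move=> eX; apply/setP=> x; rewrite in_symdiff !inE.
by have [->|] := eqVneq x e; rewrite ?(negPf eX) ?addbF.
Qed.

(** * Smallest and largest feasible sets *)

Lemma rmax_ge D X : X \in D -> #|X| <= rmax D.
Proof. by move=> XD; apply: (leq_bigmax_cond (F := fun X : {set E} => #|X|)). Qed.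

Lemma rmax_attained D : proper_system D -> exists2 X, X \in D & rmax D = #|X|.
Proof.
rewrite /proper_system -card_gt0 => D0.
by have [X XD cX] := eq_bigmax_cond (fun X : {set E} => #|X|) D0; exists X.
Qed.

Lemma width_ge D X Y : X \in D -> Y \in D -> #|Y| - #|X| <= width D.
Proof. by move=> /rmin_le ? /rmax_ge ?; rewrite leq_sub. Qed.

(** Take a smallest feasible [X] with [X :\: F] as small as possible and exchange at some [u] in
    [X :\: F]. If [v] lies in [X], the result is a proper subset of [X]; otherwise [v] lies in [F],
    and the result is again smallest but has fewer elements outside [F]. Both are impossible. *)
Lemma feasible_sup_min D F : delta_matroid D -> F \in D ->
  exists X, [/\ X \in D, #|X| = rmin D & X \subset F].
Proof.
case=> Dp Dex FD.
have [X0 X0D X0min] := rmin_attained Dp.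
pose P X := (X \in D) && (#|X| == rmin D).
have PX0 : P X0 by rewrite /P X0D -X0min eqxx.
have [X /andP[XD /eqP cX] Xopt] := arg_minnP (fun X => #|X :\: F|) PX0.
exists X; split=> //; apply/subsetP=> u uX; apply: contraT => uF.
have uXF : u \in symdiff X F by rewrite in_symdiff uX (negPf uF).
have [v [vXF XuvD]] := Dex X F XD FD u uXF.
move: vXF; rewrite in_symdiff; have [vX _|vX /= vF] := boolP (v \in X).
  have : symdiff X [set u; v] \proper X.
    apply/properP; split; last by exists u; rewrite // in_symdiff uX !inE eqxx.
    apply/subsetP=> x; rewrite in_symdiff !inE.
    by case: eqP => [->|_]; [|case: eqP => [->|_]]; rewrite ?addbF ?uX ?vX.
  by move/proper_card; have := rmin_le XuvD; lia.
have uv : u != v by apply: contraNneq vX => <-.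
have defY : symdiff X [set u; v] = v |: (X :\ u).
  apply/setP=> x; rewrite in_symdiff !inE.
  have [->|] := eqVneq x u; first by rewrite (negPf uv) uX.
  by have [->|] := eqVneq x v; rewrite ?(negPf vX) ?addbF.
have cY : P (symdiff X [set u; v]).
  rewrite /P XuvD defY cardsU1 !inE (negPf vX) andbF -cX.
  by rewrite (cardsD1 u X) uX eqxx.
have := Xopt _ cY; rewrite defY.
suff /proper_card: (v |: X :\ u) :\: F \proper X :\: F by lia.
apply/properP; split; last by exists u; rewrite !inE ?uX ?uF // eqxx (negPf uv).
apply/subsetP=> x; rewrite !inE => /andP[xF].
by case: eqP xF => [->|_ ->]; [rewrite vF | case/andP].
Qed.

(** Dual to [feasible_sup_min]: exchange at [u] in [F :\: X] either enlarges a largest [X] or swaps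
    some [v] outside [F] for [u], which shrinks [F :\: X]. *)
Lemma feasible_sub_max D F : delta_matroid D -> F \in D ->
  exists X, [/\ X \in D, #|X| = rmax D & F \subset X].
Proof.
case=> Dp Dex FD.
have [X0 X0D X0max] := rmax_attained Dp.
pose P X := (X \in D) && (#|X| == rmax D).
have PX0 : P X0 by rewrite /P X0D -X0max eqxx.
have [X /andP[XD /eqP cX] Xopt] := arg_minnP (fun X => #|F :\: X|) PX0.
exists X; split=> //; apply/subsetP=> u uF; apply: contraT => uX.
have uXF : u \in symdiff X F by rewrite in_symdiff uF (negPf uX).
have [v [vXF XuvD]] := Dex X F XD FD u uXF.
move: vXF; rewrite in_symdiff; have [vX /= vF|vX _] := boolP (v \in X); last first.
  have : X \proper symdiff X [set u; v].
    apply/properP; split; last first.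
      by exists u; rewrite // in_symdiff (negPf uX) !inE eqxx.
    apply/subsetP=> x xX; rewrite in_symdiff !inE xX.
    by case: eqP xX => [->|_]; [|case: eqP => [->|_]]; rewrite ?(negPf uX) ?(negPf vX).
  by move/proper_card; have := rmax_ge XuvD; lia.
have uv : u != v by apply: contraNneq uX => ->.
have defY : symdiff X [set u; v] = u |: (X :\ v).
  apply/setP=> x; rewrite in_symdiff !inE.
  have [->|] := eqVneq x u; first by rewrite (negPf uX).
  by have [->|] := eqVneq x v; rewrite ?vX ?addbF.
have cY : P (symdiff X [set u; v]).
  rewrite /P XuvD defY cardsU1 !inE (negPf uX) andbF -cX.
  by rewrite (cardsD1 v X) vX eqxx.
have := Xopt _ cY; rewrite defY.
suff /proper_card: F :\: (u |: X :\ v) \proper F :\: X by lia.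
apply/properP; split; last by exists u; rewrite !inE ?uX ?uF // eqxx.
apply/subsetP=> x; rewrite !inE negb_or negb_and => /andP[/andP[_ h] xF].
by move: h; rewrite xF andbT; case: eqP xF => [->|//]; rewrite (negPf vF).
Qed.

(** * Inert elements *)

Definition inert D e :=
  (forall X, X \in D -> #|X| = rmin D -> e \notin X) /\
  (forall X, X \in D -> #|X| = rmax D -> e \in X).

(** A set feasible after loop complementation at [e] is feasible before it or becomes so on removing
    [e], so each step alters a set at one entry of [s] only. *)
Lemma mem_foldl_loopc1 D s W : W \in foldl (@loopc1 E) D s ->
  exists2 F, F \in D & forall x, x \notin s -> (x \in W) = (x \in F).
Proof.
elim: s D => [|e s IHs] D /=; first by exists W.
case/IHs=> F; rewrite in_loopc1 => FD WF.
have [FinD|FnD] := boolP (F \in D).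
  by exists F => // x; rewrite inE negb_or => /andP[_ /WF].
move: FD; rewrite (negPf FnD) => /andP[_ FeD].
exists (F :\ e) => // x; rewrite !inE negb_or => /andP[xe /WF ->].
by rewrite xe.
Qed.

Lemma mem_act_word D (w : seq letter) A W : W \in act_word D w A ->
  exists2 F, F \in D & forall x, x \notin A -> (x \in W) = (x \in F).
Proof.
rewrite /act_word; elim: w D => [|l w IHw] D /=; first by exists W.
case/IHw=> F FD WF; case: l FD => /= [|/mem_foldl_loopc1[F' F'D FF']].
  rewrite in_twist => FD; exists (symdiff F A) => // x xA.
  by rewrite in_symdiff (negPf xA) addbF WF.
by exists F' => // x xA; rewrite WF // FF' // mem_enum.
Qed.

Lemma width_act_word_inert D (w : seq letter) A :
  delta_matroid D -> proper_system (act_word D w A) ->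
  (forall e, e \in A -> inert D e) -> width (act_word D w A) <= width D.
Proof.
move=> Ddm Wp Ain; apply: leq_sub.
  have [W /mem_act_word[F FD WF] ->] := rmax_attained Wp.
  have [X [XD cX FX]] := feasible_sub_max Ddm FD.
  rewrite -cX subset_leq_card //; apply/subsetP=> x xW.
  have [/Ain[_]|xA] := boolP (x \in A); first exact.
  by apply: (subsetP FX); rewrite -WF.
have [W /mem_act_word[F FD WF] ->] := rmin_attained Wp.
have [X [XD cX XF]] := feasible_sup_min Ddm FD.
rewrite -cX subset_leq_card //; apply/subsetP=> x xX.
have [/Ain[/(_ X XD cX)]|xA] := boolP (x \in A); first by rewrite xX.
by rewrite WF //; apply: (subsetP XF).
Qed.

(** On a single element the two letters act as involutions generating the symmetric group of degree
    three; these words are its elements of order three. *)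
Definition triality (w : seq letter) :=
  w = [:: Star; Times] \/ w = [:: Times; Star].

(** * Effect of a single element on the extreme cardinalities *)

Lemma minimal_notin D e X : X \in D -> #|X| = rmin D -> e \in X -> X :\ e \notin D.
Proof.
move=> XD cX eX; apply: contraL (leqnn #|X|) => /rmin_le.
by rewrite -cX (cardsD1 e X) eX ltnn.
Qed.

Lemma maximal_notin D e X : X \in D -> #|X| = rmax D -> e \notin X -> e |: X \notin D.
Proof.
move=> XD cX eX; apply: contraL (leqnn #|X|) => /rmax_ge.
by rewrite -cX cardsU1 eX ltnn.
Qed.

Lemma act_word_set1 D w e : triality w ->
  act_word D w [set e] = loopc1 (twist D [set e]) e \/
  act_word D w [set e] = twist (loopc1 D e) [set e].
Proof. by case=> ->; rewrite /act_word /= loopc_set1; [left|right]. Qed.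

(** Record by bits [(a, b)] whether the sets of a pair [Y], [e |: Y] with [e] not in [Y] are
    feasible. The two words send [(a, b)] to [(b, a + b)] and [(a + b, a)] modulo 2. Here [(0, 1)]
    becomes [(1, 1)] or [(1, 0)]. *)
Lemma triality_setD1 D w e X : triality w -> e \in X -> X \in D ->
  X :\ e \notin D -> X :\ e \in act_word D w [set e].
Proof.
move=> tw eX XD XeD; have eXe : e \notin X :\ e by rewrite !inE eqxx.
have [->|->] := act_word_set1 D e tw; rewrite !(in_loopc1, in_twist);
  by rewrite symdiff_set1_notin // setD1K ?XD ?eX ?(negPf XeD) ?(negPf eXe).
Qed.

(** In terms of bits, [(1, 0)] becomes [(0, 1)] or [(1, 1)]. *)
Lemma triality_setU1 D w e X : triality w -> e \notin X -> X \in D ->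
  e |: X \notin D -> e |: X \in act_word D w [set e].
Proof.
move=> tw eX XD XeD; have eXe : e \in e |: X by rewrite !inE eqxx.
have [->|->] := act_word_set1 D e tw; rewrite !(in_loopc1, in_twist);
  by rewrite symdiff_set1_in // ?setU1K // ?symdiff_set1_notin //
    ?XD ?eX ?(negPf XeD) ?(negPf eX) ?andbF.
Qed.

(** In terms of bits, [(1, 1)] becomes [(1, 0)] or [(0, 1)], depending on the word. *)
Lemma triality_pair D w e X : triality w -> e \notin X -> X \in D ->
  e |: X \in D -> X \in act_word D w [set e] \/ e |: X \in act_word D w [set e].
Proof.
move=> tw eX XD XeD.
have [->|->] := act_word_set1 D e tw; [left|right]; rewrite !(in_loopc1, in_twist).
  by rewrite symdiff_set1_notin // XeD (negPf eX).
by rewrite symdiff_set1_in ?setU11 // setU1K // XD (negPf eX).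
Qed.

(** A nonzero pair of bits never becomes zero, so [X :\ e] or [e |: X] is feasible afterwards. If
    [e] is in [X], minimality keeps [X :\ e] out of [D], which forces it in afterwards. *)
Lemma triality_near_min D w e X : triality w -> X \in D -> #|X| = rmin D ->
  exists2 Y, Y \in act_word D w [set e] & #|Y| <= #|X|.+1.
Proof.
move=> tw XD cX; have [eX|eX] := boolP (e \in X).
  exists (X :\ e); first exact/triality_setD1/minimal_notin.
  by rewrite (cardsD1 e X) eX; lia.
have ceX : #|e |: X| = #|X|.+1 by rewrite cardsU1 eX.
have [XeD|XeD] := boolP (e |: X \in D).
  by have [] := triality_pair tw eX XD XeD; [exists X|exists (e |: X); rewrite ?ceX].
by exists (e |: X); [exact: triality_setU1|rewrite ceX].
Qed.

Lemma triality_near_max D w e X : triality w -> X \in D -> #|X| = rmax D ->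
  exists2 Y, Y \in act_word D w [set e] & #|X| <= #|Y|.+1.
Proof.
move=> tw XD cX; have [eX|eX] := boolP (e \in X); last first.
  exists (e |: X); first exact/triality_setU1/maximal_notin.
  by rewrite cardsU1 eX; lia.
have ceX : #|X| = #|X :\ e|.+1 by rewrite (cardsD1 e X) eX.
have [XeD|XeD] := boolP (X :\ e \in D); last first.
  by exists (X :\ e); [exact: triality_setD1|rewrite ceX].
have eXe : e \notin X :\ e by rewrite !inE eqxx.
have := triality_pair tw eXe XeD; rewrite setD1K // => /(_ XD).
by case; [exists (X :\ e); rewrite ?ceX|exists X].
Qed.

Lemma width_triality_inert D w e : triality w -> proper_system D ->
  width (act_word D w [set e]) < width D -> inert D e.
Proof.
move=> tw Dp; rewrite ltnNge => small.
have [X XD /esym cX] := rmin_attained Dp; have [Y YD /esym cY] := rmax_attained Dp.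
split=> Z ZD cZ.
  apply: contra small => eZ.
  have ZeD := triality_setD1 tw eZ ZD (minimal_notin ZD cZ eZ).
  have [V VD' cV] := triality_near_max e tw YD cY.
  apply: leq_trans (width_ge ZeD VD').
  (* The possible loss of one in [V] is offset by [Z :\ e], which has one element fewer than
     [rmin D]. *)
  by move: cZ cV; rewrite /width (cardsD1 e Z) eZ; lia.
apply: contraR small => eZ.
have ZeD := triality_setU1 tw eZ ZD (maximal_notin ZD cZ eZ).
have [V VD' cV] := triality_near_min e tw XD cX.
apply: leq_trans (width_ge VD' ZeD).
by rewrite /width cardsU1 eZ; lia.
Qed.

(** * Splitting one element off a set *)

Lemma foldl_loopc1_perm D s t :
  perm_eq s t -> foldl (@loopc1 E) D s = foldl (@loopc1 E) D t.
Proof.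
(* By commutation any entry can be moved to the front. *)
have cat e r1 r2 D' : foldl (@loopc1 E) D' (r1 ++ e :: r2) =
    foldl (@loopc1 E) (loopc1 D' e) (r1 ++ r2).
  by elim: r1 D' => //= f r1 IHr D'; rewrite IHr loopc1C.
elim: s t D => [|e s IHs] t D st.
  by move: st; rewrite perm_sym => /perm_nilP->.
have et : e \in t by rewrite -(perm_mem st) mem_head.
case/splitPr: et st => r1 r2; rewrite cat => st /=; apply: IHs.
by rewrite -(perm_cons e) (perm_trans st) // perm_catC /= perm_cons perm_catC.
Qed.

Lemma loopc_setU1 D e A : e \notin A -> loopc D (e |: A) = loopc (loopc1 D e) A.
Proof.
move=> eA; rewrite /loopc -[RHS]/(foldl (@loopc1 E) D (e :: enum A)).
apply/foldl_loopc1_perm/uniq_perm; rewrite /= ?enum_uniq ?mem_enum ?eA //.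
by move=> x; rewrite inE !mem_enum !inE.
Qed.

Lemma symdiffA (A B C : {set E}) : symdiff (symdiff A B) C = symdiff A (symdiff B C).
Proof. by apply/setP=> x; rewrite !in_symdiff addbA. Qed.

Lemma symdiffC A B : symdiff A B = symdiff B A.
Proof. by apply/setP=> x; rewrite !in_symdiff addbC. Qed.

Lemma twist_symdiff D A B : twist D (symdiff A B) = twist (twist D A) B.
Proof. by apply/setP=> X; rewrite !in_twist symdiffA (symdiffC A). Qed.

Lemma twist_setU1 D e A : e \notin A ->
  twist D (e |: A) = twist (twist D [set e]) A.
Proof. by move=> eA; rewrite -twist_symdiff symdiffC symdiff_set1_notin. Qed.

Lemma twist_loopc1 D e A : e \notin A ->
  twist (loopc1 D e) A = loopc1 (twist D A) e.
Proof.
move=> eA; apply/setP=> X; rewrite !(in_loopc1, in_twist) in_symdiff (negPf eA).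
rewrite addbF; congr (_ (+) (_ && (_ \in D))); apply/setP=> x.
rewrite !(in_symdiff, in_setD1).
by have [->|] := eqVneq x e; rewrite ?(negPf eA).
Qed.

Lemma twist_foldl_loopc1 D A s : {in s, forall x, x \notin A} ->
  twist (foldl (@loopc1 E) D s) A = foldl (@loopc1 E) (twist D A) s.
Proof.
elim: s D => //= e s IHs D sA; rewrite IHs => [|x xs]; last first.
  by apply: sA; rewrite inE xs orbT.
by rewrite twist_loopc1 ?sA ?mem_head.
Qed.

(** Each letter splits at [e]; the factors are then reordered because a twist and a loop
    complementation on disjoint sets commute. *)
Lemma triality_setU1_word D w e A : triality w -> e \notin A ->
  act_word D w (e |: A) = act_word (act_word D w [set e]) w A.
Proof.
move=> tw eA; rewrite /act_word; case: tw => -> /=.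
  rewrite loopc_setU1 // twist_setU1 // loopc_set1 -twist_loopc1 //.
rewrite loopc_setU1 // twist_setU1 // loopc_set1; congr (twist _ A).
rewrite /loopc twist_foldl_loopc1 // => x; rewrite mem_enum inE => xA.
by apply: contraNneq eA => <-.
Qed.

Lemma vf_safe_act_word D w A : vf_safe D -> vf_safe (act_word D w A).
Proof.
rewrite /act_word; elim: w D => //= l w IHw D hD; apply: IHw => ops.
exact: (hD ((l, A) :: ops)).
Qed.

(** * Greedy construction of the ordering *)

Lemma monotone_path D w A : vf_safe D -> triality w ->
  exists s, [/\ uniq s, {subset s <= A},
    width (act_word D w A) <= width (act_word D w [set x in s])
    & sorted leq (mkseq (fun i => width (act_word D w [set x in take i s]))
                        (size s).+1)].
Proof.
move=> + tw; move: {2}#|A| (erefl #|A|) => n; elim: n => [|n IHn] in D A *.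
  by move/cards0_eq=> -> _; exists [::]; split.
move=> cA hD; have D_dm : delta_matroid D := hD [::].
have [le|lt] := leqP (width (act_word D w A)) (width D).
  (* When [A] gives no gain over [D], the ordering stops; [s] therefore need not exhaust [A]. *)
  by exists [::]; split=> //=; rewrite set_nil act_word_set0.
have [e /andP[eA le_e]] : exists e,
    (e \in A) && (width D <= width (act_word D w [set e])).
  apply/existsP; apply: contraLR lt; rewrite negb_exists -leqNgt => /forallP nA.
  apply: width_act_word_inert => // [|e eA]; first exact: (vf_safe_act_word w A hD [::]).1.
  by apply: width_triality_inert tw D_dm.1 _; have := nA e; rewrite eA ltnNge.
have eAe : e \notin A :\ e by rewrite !inE eqxx.
have cAe : #|A :\ e| = n by move: cA; rewrite (cardsD1 e A) eA => -[].
have [s [us sA le_s sort_s]] := IHn _ _ cAe (vf_safe_act_word w [set e] hD).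
have es : e \notin s by apply: contra eAe; apply: sA.
have act_cons r : {subset r <= s} -> act_word D w [set x in e :: r] =
    act_word (act_word D w [set e]) w [set x in r].
  by move=> rs; rewrite set_cons triality_setU1_word // inE; apply: contra es; apply: rs.
exists (e :: s); split.
- by rewrite /= es us.
- by move=> x; rewrite inE => /predU1P[->//|/sA]; rewrite !inE => /andP[].
- by rewrite act_cons // -triality_setU1_word // setD1K in le_s *.
(* The sequence of widths along [e :: s] is [width D] followed by the sequence along [s] that starts
   from [act_word D w [set e]]; [le_e] gives the first comparison. *)
rewrite /mkseq -[iota 0 _]/(0 :: iota (1 + 0) (size s).+1) iotaDl map_cons -map_comp.
rewrite take0 set_nil act_word_set0.
under eq_map => i.
  rewrite /= act_cons; last by move=> x; apply: mem_take.
  over.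
by move: sort_s le_e; rewrite /mkseq /= take0 set_nil act_word_set0 => -> ->.
Qed.

End Width.

Theorem corollary4p7 (E : finType) (D : {set {set E}}) (sigma : seq letter)
  (hD : vf_safe D)
  (hsigma : sigma = [:: Star; Times] \/ sigma = [:: Times; Star]) :
  exists (A : {set E}) (e : seq E),
    [/\ uniq e /\ e =i A,
        width (act_word D sigma A) =
          \max_(B : {set E}) width (act_word D sigma B)
      & sorted leq
          (mkseq (fun i => width (act_word D sigma [set x in take i e]))
                 (size e).+1)].
Proof.
have [A _ Amax] := arg_maxnP (fun B => width (act_word D sigma B))
  (erefl (xpredT (set0 : {set E}))).
have [s [us _ le_s sort_s]] := monotone_path A hD hsigma.
(* The set of entries of [s] may be smaller than the maximiser [A], but it gives at least the same
   width and so is a maximiser too. *)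
exists [set x in s], s; split=> //; first by split=> // x; rewrite inE.
apply/eqP; rewrite eqn_leq; apply/andP; split.
  exact: (@leq_bigmax _ (fun B : {set E} => width (act_word D sigma B))).
by apply/bigmax_leqP=> B _; apply: leq_trans le_s; apply: Amax.
Qed.
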